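(* Let $A$ be a finite non-empty subset of a commutative group $G$ and let $K$ be a real number. If $\max\{|A+A|, |A-A|\} \leq K|A|$, then $|A-2\cdot A| \leq K^{2.95}|A|$.
   Context: The group $G$ is written additively. $A+A=\{a+a' : a,a'\in A\}$, $A-A=\{a-a' : a,a'\in A\}$, and $A-2\cdot A=\{a-a'-a' : a,a'\in A\}$. *)

(* Defs.v *)
From mathcomp Require Import all_boot all_order all_algebra finmap.

Set Implicit Arguments.
Unset Strict Implicit.
Unset Printing Implicit Defensive.

Import GRing.Theory.
Local Open Scope fset_scope.
Local Open Scope ring_scope.

Definition sumset (G : zmodType) (A B : {fset G}) : {fset G} :=
  [fset a + b | a in A, b in B].

Definition diffset (G : zmodType) (A B : {fset G}) : {fset G} :=
  [fset a - b | a in A, b in B].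

(* The dilate {a + a : a in A}, not the sumset A + A, which contains it. *)
Definition dilate2 (G : zmodType) (A : {fset G}) : {fset G} :=
  [fset a *+ 2 | a in A].

(* Main.v *)
Require Import Defs.
From mathcomp Require Import all_boot all_order all_algebra finmap.
From mathcomp Require Import reals exp.
From mathcomp Require Import boolp zify ring lra.
Set Implicit Arguments.
Unset Strict Implicit.
Unset Printing Implicit Defensive.
Import Order.TTheory GRing.Theory Num.Theory.
Local Open Scope ring_scope.

(** Write D = A - 2.A and let X be a non-empty subset of A for which
    |X + A| / |X| is least.  By Petridis's argument
    ([card_sumset_min_growth]), |X + A + C| |X| <= |X + A| |X + C| for every
    finite set C.  Fix for each d in D a representation d = y - 2z, and for x
    in X put r = y - z + x and s = z + x.  Then

      r - s = d   and   r + s = x + y + x,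

    so that r lies in X + A - A, of size at most K^2 |A|; s in X + A, of size
    at most K |X|; and r + s in X + A + A, of size at most K^2 |X|.  The pairs
    (r, s) are |D| |X| in number, which already gives |D| <= K^3 |A|.

    Suppose that this is nearly sharp.  Then r and s are nearly independent,
    yet r + s has no more room than r alone.  Two consequences of the
    submodularity of Shannon entropy ([entropy_submod]) contradict each other.
    Take copies s0, s1, s2 of s that are independent given r.
    - Adding a second and a third copy of s to r gains as little as adding the
      first, so r + s0 + s1 + s2 has entropy close to that of r; hence so has
      s0 + s1 + s2, which is nearly independent of r.  This is about
      log |A| + 2 log K.
    - Ruzsa's triangle r - s0 = (r + m) - (s0 + m) recovers d from r + m and
      s0 + m.  For m = s1 it shows that s0 + s1 already has entropy about
      log |A| + 2 log K, and then for m = s1 + s2 that s0 + s1 + s2 has entropy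
      about log |A| + 3 log K.

    Keeping track of the errors ([ln_card_sum_difference]) gives
    |D|^15 |X|^15 <= |X+A-A|^10 |X+A|^12 |X+A+A|^6 |X|^2, that is,
    |D| <= K^(44/15) |A|, and 44/15 < 2.95. *)

(** * Entropy of functions on a finite probability space *)

Definition level_prob (R : realType) (T : finType) (p : T -> R) (U : eqType)
    (f : T -> U) (w : T) : R := \sum_(v | f v == f w) p v.

(** Summing over points rather than over values of [f] makes the codomain
    irrelevant: only the partition of [T] into classes of [f] matters. *)
Definition entropy (R : realType) (T : finType) (p : T -> R) (U : eqType)
    (f : T -> U) : R := - \sum_w p w * ln (level_prob p f w).

Lemma level_prob_gt0 (R : realType) (T : finType) (p : T -> R) (U : eqType)
    (f : T -> U) (w : T) :
    (forall v, 0 < p v) ->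
  0 < level_prob p f w.
Proof.
move=> p_gt0; rewrite /level_prob (bigD1 w) //=.
by rewrite ltr_pwDl ?p_gt0 // sumr_ge0 // => v _; apply: ltW.
Qed.

Lemma le_ln_subr1 (R : realType) (x : R) : 0 < x -> ln x <= x - 1.
Proof.
move=> x_gt0; have := @le_ln1Dx R (x - 1).
by rewrite addrCA subrr addr0; apply; lra.
Qed.

(** Inside one class of [f] the quotients are conditional probabilities. *)
Lemma sum_ratio_same_class (R : realType) (T : finType) (p : T -> R)
    (U : eqType) (f : T -> U) (P : pred T) :
    (forall v, 0 < p v) -> {in P &, forall v w, f v = f w} ->
  \sum_(w | P w) p w / level_prob p f w <= 1.
Proof.
move=> p_gt0 fP; case: (pickP P) => [w0 Pw0 | P0]; last first.
  by rewrite big_pred0.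
have fw0 w : P w -> level_prob p f w = level_prob p f w0.
  by move=> Pw; rewrite /level_prob (fP w w0).
under eq_bigr => w Pw do rewrite fw0 //.
rewrite -mulr_suml ler_pdivrMr ?level_prob_gt0 // mul1r /level_prob.
rewrite [leLHS]big_mkcond [leRHS]big_mkcond /=; apply: ler_sum => w _.
case: ifP => Pw; first by rewrite (fP w w0) // eqxx.
by case: ifP => // _; apply: ltW.
Qed.

(** Submodularity, phrased with functional dependencies instead of joint
    variables: [c] may be any common coarsening of [f] and [h], and [j] anything
    that they determine together.  By concavity of the logarithm it is enough
    that the mean of P(f) P(h) / (P(j) P(c)) is at most 1; this mean is the
    total mass, restricted to compatible pairs, of drawing a class of [f] and
    then a class of [h] independently within the class of [c]. *)
Lemma entropy_submod (R : realType) (T : finType) (p : T -> R)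
    (J F H C : eqType) (j : T -> J) (f : T -> F) (h : T -> H) (c : T -> C) :
    (forall v, 0 < p v) -> \sum_v p v = 1 ->
    (forall v w, f v = f w -> c v = c w) ->
    (forall v w, h v = h w -> c v = c w) ->
    (forall v w, f v = f w -> h v = h w -> j v = j w) ->
  entropy p j + entropy p c <= entropy p f + entropy p h.
Proof.
move=> p_gt0 p1 fc hc fhj.
have L_gt0 (U : eqType) (g : T -> U) w : 0 < level_prob p g w.
  exact: level_prob_gt0.
pose x w := level_prob p f w * level_prob p h w /
            (level_prob p j w * level_prob p c w).
have x_gt0 w : 0 < x w by rewrite divr_gt0 ?mulr_gt0.
suff sum_x : \sum_w p w * x w <= 1.
  rewrite /entropy -!opprD lerN2 -!big_split /= -subr_le0 -sumrB.
  have -> : \sum_w ((p w * ln (level_prob p f w) + p w * ln (level_prob p h w))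
      - (p w * ln (level_prob p j w) + p w * ln (level_prob p c w))) =
      \sum_w p w * ln (x w).
    apply: eq_bigr => w _; rewrite /x ln_div ?posrE ?mulr_gt0 //.
    by rewrite !lnM ?posrE //; ring.
  have le1 : \sum_w p w * ln (x w) <= \sum_w p w * (x w - 1).
    by apply: ler_sum => w _; rewrite ler_wpM2l ?le_ln_subr1 // ltW.
  apply: (le_trans le1); under eq_bigr => w _ do rewrite mulrBr mulr1.
  by rewrite sumrB p1 subr_le0.
(* Write the numerators as sums over v1 in the class of f and v2 in the class
   of h at w; then c takes the same value at v1, v2 and w, so that the sum over
   w can be done first and meets a single class of j. *)
have step w : p w * x w =
    \sum_v1 \sum_v2 (if (f v1 == f w) && (h v2 == h w) && (c v1 == c v2) then
      p v1 * (p v2 / level_prob p c v1) * (p w / level_prob p j w) else 0).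
  have -> : p w * x w = \sum_(v1 | f v1 == f w) \sum_(v2 | h v2 == h w)
      p v1 * (p v2 / level_prob p c w) * (p w / level_prob p j w).
    under eq_bigr => v1 _ do rewrite -mulr_suml -mulr_sumr -mulr_suml.
    rewrite -!mulr_suml -/(level_prob p h w) -/(level_prob p f w) /x.
    by rewrite invfM; ring.
  rewrite big_mkcond /=; apply: eq_bigr => v1 _; case: eqP => [f1|_] /=; last first.
    by rewrite big1.
  rewrite big_mkcond /=; apply: eq_bigr => v2 _; case: eqP => [h2|_] //=.
  have c12 : c v1 = c w by apply: fc.
  by rewrite (hc _ _ h2) c12 eqxx /level_prob c12.
under eq_bigr => w _ do rewrite step.
rewrite exchange_big /= -[leRHS]p1; apply: ler_sum => v1 _.
rewrite exchange_big /= -[leRHS]mulr1.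
have -> : \sum_v2 \sum_w (if (f v1 == f w) && (h v2 == h w) && (c v1 == c v2)
      then p v1 * (p v2 / level_prob p c v1) * (p w / level_prob p j w) else 0) =
    p v1 * \sum_(v2 | c v1 == c v2) (p v2 / level_prob p c v1 *
       \sum_(w | (f v1 == f w) && (h v2 == h w)) p w / level_prob p j w).
  rewrite mulr_sumr [RHS]big_mkcond /=; apply: eq_bigr => v2 _.
  case: (c v1 == c v2); last by rewrite big1 // => w _; rewrite andbF.
  rewrite !mulr_sumr [RHS]big_mkcond /=; apply: eq_bigr => w _.
  by rewrite andbT -mulrA.
rewrite ler_wpM2l ?(ltW (p_gt0 _)) //.
apply: (@le_trans _ _ (\sum_(v2 | c v1 == c v2) p v2 / level_prob p c v1)).
  apply: ler_sum => v2 _; rewrite ler_piMr //; first by rewrite divr_ge0 // ltW.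
  apply: sum_ratio_same_class => // w w' /andP[/eqP f1 /eqP h1] /andP[/eqP f2 /eqP h2].
  by apply: fhj; rewrite -?f1 -?h1.
rewrite -mulr_suml /level_prob.
under eq_bigl => v2 do rewrite eq_sym.
by rewrite divff // gt_eqF // L_gt0.
Qed.

Lemma entropy_cst (R : realType) (T : finType) (p : T -> R) :
  \sum_v p v = 1 -> entropy p (fun=> tt) = 0.
Proof.
move=> p1; rewrite /entropy big1 ?oppr0 // => w _.
by rewrite /level_prob (eq_bigl xpredT) // p1 ln1 mulr0.
Qed.

Lemma entropy_subadd (R : realType) (T : finType) (p : T -> R)
    (J F H : eqType) (j : T -> J) (f : T -> F) (h : T -> H) :
    (forall v, 0 < p v) -> \sum_v p v = 1 ->
    (forall v w, f v = f w -> h v = h w -> j v = j w) ->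
  entropy p j <= entropy p f + entropy p h.
Proof.
move=> p_gt0 p1 fhj.
by rewrite -[leLHS]addr0 -(entropy_cst p1) entropy_submod.
Qed.

(** The mean of 1 / P(f) is the number of classes of [f]. *)
Lemma entropy_le_ln_card (R : realType) (T : finType) (p : T -> R)
    (U : choiceType) (f : T -> U) (S : {fset U}) :
    (forall v, 0 < p v) -> \sum_v p v = 1 -> (forall v, f v \in S) ->
  entropy p f <= ln #|` S|%:R.
Proof.
move=> p_gt0 p1 fS.
have L_gt0 w : 0 < level_prob p f w by apply: level_prob_gt0.
have n_gt0 : 0 < #|` S|%:R :> R.
  rewrite ltr0n cardfs_gt0; apply/fset0Pn.
  case: (pickP T) => [w _|T0]; first by exists (f w).
  by move: p1; rewrite big_pred0 // => /eqP; rewrite eq_sym oner_eq0.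
set n : R := #|` S|%:R in n_gt0 *.
have classes : \sum_w p w / level_prob p f w <= n.
  rewrite (partition_big (fun w => [` fS w]%fset) xpredT) //=.
  have -> : n = \sum_(s : S) 1 by rewrite sumr_const -cardfE.
  apply: ler_sum => s _; apply: sum_ratio_same_class => // v w.
  by rewrite !unfold_in => /eqP <- /eqP/(congr1 val) /= ->.
rewrite -subr_le0 -[X in _ - X]mul1r -p1 mulr_suml -opprD -big_split /=.
rewrite oppr_le0; under eq_bigr => w _ do rewrite -mulrDr -lnM ?posrE //.
rewrite -oppr_le0 -sumrN.
have le1 : \sum_w - (p w * ln (level_prob p f w * n)) <=
           \sum_w (p w / level_prob p f w / n - p w).
  apply: ler_sum => w _; rewrite -mulrN -lnV ?posrE ?mulr_gt0 //.
  rewrite -[X in _ - X]mulr1 -!mulrA -mulrBr ler_wpM2l ?(ltW (p_gt0 _)) //.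
  by rewrite -invfM le_ln_subr1 // invr_gt0 mulr_gt0.
apply: (le_trans le1); rewrite sumrB p1 -mulr_suml subr_le0.
by rewrite ler_pdivrMr // mul1r.
Qed.

Lemma entropy_le_ln_card_fintype (R : realType) (T U : finType) (p : T -> R)
    (f : T -> U) :
    (forall v, 0 < p v) -> \sum_v p v = 1 -> entropy p f <= ln #|U|%:R.
Proof.
move=> p_gt0 p1; have := @entropy_le_ln_card _ _ p _ f [fset u in U]%fset.
by rewrite card_finset; apply=> // v; rewrite !inE.
Qed.

(** * Three conditionally independent copies over a function *)

Definition fiber_triple (W : finType) (V : eqType) (r : W -> V) : finType :=
  {t : W * W * W | (r t.1.1 == r t.1.2) && (r t.1.1 == r t.2)}.

Definition fiber_size (R : realType) (W : finType) (V : eqType) (r : W -> V)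
  (w : W) : R := #|[pred v | r v == r w]|%:R.

(** The law of three points of [W], each of them uniform, that share the value
    of [r] and are independent given it: choose the first point uniformly and
    then the other two uniformly in its fibre. *)
Definition triple_prob (R : realType) (W : finType) (V : eqType) (r : W -> V)
    (t : fiber_triple r) : R :=
  (#|W|%:R * fiber_size R r (val t).1.1 ^+ 2)^-1.

Lemma sum_fiber_triple (R : realType) (W : finType) (V : eqType) (r : W -> V)
    (P : pred W) (F : W * W * W -> R) :
  \sum_(t : fiber_triple r | P (val t).1.1) F (val t) =
  \sum_(w0 | P w0) \sum_(w1 | r w1 == r w0) \sum_(w2 | r w2 == r w0) F (w0, w1, w2).
Proof.
under [RHS]eq_bigr => w0 _ do rewrite pair_big_dep /=.
rewrite pair_big_dep /=.
rewrite (reindex (fun t : W * W * W => (t.1.1, (t.1.2, t.2)))) /=; last first.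
  by exists (fun u => (u.1, u.2.1, u.2.2)) => [[[? ?] ?]|[? [? ?]]].
rewrite [RHS](eq_bigr F) => [|[[? ?] ?] //].
rewrite [RHS](reindex_omap (val : fiber_triple r -> _) insub) /=; last first.
  case=> [[w0 w1] w2] /= /andP[_ /andP[/eqP r1 /eqP r2]].
  by rewrite insubT /= ?r1 ?r2 ?eqxx.
apply: eq_bigl => -[[[w0 w1] w2] /= rt]; rewrite insubT /= eqxx andbT.
by have /andP[/eqP <- /eqP <-] := rt; rewrite eqxx !andbT.
Qed.

Lemma fiber_size_gt0 (R : realType) (W : finType) (V : eqType) (r : W -> V)
  (w : W) : 0 < fiber_size R r w.
Proof. by rewrite ltr0n; apply/card_gt0P; exists w; rewrite inE. Qed.

Lemma triple_prob_gt0 (R : realType) (W : finType) (V : eqType) (r : W -> V)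
    (t : fiber_triple r) : 0 < triple_prob R t.
Proof.
rewrite invr_gt0 mulr_gt0 ?exprn_gt0 ?fiber_size_gt0 // ltr0n.
by apply/card_gt0P; exists (val t).1.1.
Qed.

Lemma sum_triple_prob (R : realType) (W : finType) (V : eqType) (r : W -> V)
    (P : pred W) :
  \sum_(t : fiber_triple r | P (val t).1.1) triple_prob R t =
  #|[pred w | P w]|%:R / #|W|%:R.
Proof.
rewrite (@sum_fiber_triple R W V r P
  (fun t => (#|W|%:R * fiber_size R r t.1.1 ^+ 2)^-1)) /=.
rewrite -[#|[pred w | P w]|]sum1_card natr_sum mulr_suml; apply: eq_bigr => w _.
rewrite !sumr_const -/(fiber_size R r w) -!mulrnA -[_ *+ _]mulr_natr natrM.
rewrite -/(fiber_size R r w) invfM -expr2 mul1r -mulrA mulVf ?mulr1 //.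
by rewrite expf_neq0 // gt_eqF // fiber_size_gt0.
Qed.

(** The chain rule for conditionally independent copies:
    H(w0, w1, w2) = H(r) + 3 (H(w) - H(r)). *)
Lemma entropy_fiber_triple (R : realType) (W : finType) (V : eqType)
    (r : W -> V) :
    (0 < #|W|)%N ->
  entropy (@triple_prob R W V r) id +
  entropy (@triple_prob R W V r) (fun t => r (val t).1.1) *+ 2 =
  ln #|W|%:R *+ 3.
Proof.
move=> W_gt0; have n_gt0 : 0 < #|W|%:R :> R by rewrite ltr0n.
rewrite /entropy mulNrn -opprD -sumrMnl -big_split /=.
have sum1 : \sum_t @triple_prob R W V r t = 1.
  rewrite (sum_triple_prob R r xpredT) (eq_card (B := W)) // divff //.
  by rewrite gt_eqF.
transitivity (- \sum_t (@triple_prob R W V r t * - (ln #|W|%:R *+ 3))).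
  congr (- _); apply: eq_bigr => t _.
  have -> : level_prob (@triple_prob R W V r) id t = triple_prob R t.
    by rewrite /level_prob (big_pred1 t).
  have -> : level_prob (@triple_prob R W V r) (fun t => r (val t).1.1) t =
            fiber_size R r (val t).1.1 / #|W|%:R.
    by rewrite /level_prob (sum_triple_prob R r (fun w => r w == r (val t).1.1)).
  have c_gt0 := fiber_size_gt0 R r (val t).1.1.
  rewrite -mulrnAr -mulrDr; congr (_ * _).
  rewrite {1}/triple_prob lnV ?posrE ?mulr_gt0 ?exprn_gt0 //.
  by rewrite lnM ?posrE ?exprn_gt0 // lnXn // ln_div ?posrE //; ring.
by rewrite -mulr_suml sum1 mul1r opprK.
Qed.

(** * Sums and differences along a graph *)

(** A graph whose edges [w] join [r w] to [s w], with few sums [r w + s w],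
    cannot have many differences.  Here [x] tells apart the edges with a given
    difference, so #|W| / #|X| bounds the number of differences from below.
    The proof is a list of submodularity inequalities on triples of edges with
    a common [r]; the exponents come from eliminating the intermediate
    entropies. *)
Lemma ln_card_sum_difference (R : realType) (G : zmodType) (W : finType)
    (Y : choiceType) (r s : W -> G) (x : W -> Y)
    (B S Q : {fset G}) (X : {fset Y}) :
    (0 < #|W|)%N ->
    (forall w, r w \in B) -> (forall w, s w \in S) ->
    (forall w, r w + s w \in Q) -> (forall w, x w \in X) ->
    (forall v w, r v = r w -> s v = s w -> v = w) ->
    (forall v w, r v - s v = r w - s w -> x v = x w -> v = w) ->
  15 * ln #|W|%:R <=
  10 * ln #|` B|%:R + 12 * ln #|` S|%:R + 6 * ln #|` Q|%:R + 2 * ln #|` X|%:R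
    :> R.
Proof.
move=> W_gt0 rB sS rsQ xX inj_rs inj_dx.
pose T := fiber_triple r; pose p : T -> R := @triple_prob R W G r.
have p_gt0 v : 0 < p v by exact: triple_prob_gt0.
have p1 : \sum_v p v = 1.
  rewrite (sum_triple_prob R r xpredT) (eq_card (B := W)) // divff //.
  by rewrite gt_eqF // ltr0n.
pose w0 (t : T) := (val t).1.1; pose w1 (t : T) := (val t).1.2.
pose w2 (t : T) := (val t).2; pose rho t := r (w0 t).
have r1 t : r (w1 t) = rho t by have /andP[/eqP] := valP t.
have r2 t : r (w2 t) = rho t by have /andP[_ /eqP] := valP t.
pose s0 t := s (w0 t); pose s1 t := s (w1 t); pose s2 t := s (w2 t).
have e0 t u : rho t = rho u -> s0 t = s0 u -> w0 t = w0 u.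
  exact: inj_rs.
have e1 t u : rho t = rho u -> s1 t = s1 u -> w1 t = w1 u.
  by rewrite -!r1; apply: inj_rs.
have e2 t u : rho t = rho u -> s2 t = s2 u -> w2 t = w2 u.
  by rewrite -!r2; apply: inj_rs.
have d0 t u : rho t - s0 t = rho u - s0 u -> x (w0 t) = x (w0 u) -> w0 t = w0 u.
  exact: inj_dx.
have d1 t u : rho t - s1 t = rho u - s1 u -> x (w1 t) = x (w1 u) -> w1 t = w1 u.
  by rewrite -!r1; apply: inj_dx.
have f0 t u : w0 t = w0 u -> rho t = rho u /\ s0 t = s0 u.
  by rewrite /rho /s0 => ->.
have f1 t u : w1 t = w1 u -> rho t = rho u /\ s1 t = s1 u.
  by rewrite -!r1 /s1 => ->.
have f2 t u : w2 t = w2 u -> rho t = rho u /\ s2 t = s2 u.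
  by rewrite -!r2 /s2 => ->.
have triple_inj t u : w0 t = w0 u -> w1 t = w1 u -> w2 t = w2 u -> t = u.
  rewrite /w0 /w1 /w2 => a b c; apply: val_inj.
  by case: (val t) (val u) a b c => [[? ?] ?] [[? ?] ?] /= -> -> ->.
have subDD (a b c : G) : (a + c) - (b + c) = a - b.
  by rewrite opprD addrACA subrr addr0.
have sub (J F H C : eqType) (j : T -> J) (f : T -> F) (h : T -> H) (c : T -> C) :
    (forall v w, f v = f w -> c v = c w) ->
    (forall v w, h v = h w -> c v = c w) ->
    (forall v w, f v = f w -> h v = h w -> j v = j w) ->
    entropy p j + entropy p c <= entropy p f + entropy p h.
  exact: entropy_submod.
have add (J F H : eqType) (j : T -> J) (f : T -> F) (h : T -> H) :
    (forall v w, f v = f w -> h v = h w -> j v = j w) ->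
    entropy p j <= entropy p f + entropy p h.
  exact: entropy_subadd.
have card (U : choiceType) (f : T -> U) (Z : {fset U}) :
    (forall v, f v \in Z) -> entropy p f <= ln #|` Z|%:R.
  exact: entropy_le_ln_card.
have addp (F H : eqType) (f : T -> F) (h : T -> H) :
    entropy p (fun t => (f t, h t)) <= entropy p f + entropy p h.
  by apply: add => v w -> ->.
pose P t := (w1 t, w2 t).
pose u t := s1 t + s2 t; pose m t := rho t + u t.
pose sg t := s0 t + u t; pose n t := rho t + sg t.
have hB : entropy p rho <= ln #|` B|%:R by apply: card => v; apply: rB.
have hS0 : entropy p s0 <= ln #|` S|%:R by apply: card => v; apply: sS.
have hS1 : entropy p s1 <= ln #|` S|%:R by apply: card => v; apply: sS.
have hS2 : entropy p s2 <= ln #|` S|%:R by apply: card => v; apply: sS.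
have hQ0 : entropy p (fun t => rho t + s0 t) <= ln #|` Q|%:R.
  by apply: card => v; apply: rsQ.
have hQ1 : entropy p (fun t => rho t + s1 t) <= ln #|` Q|%:R.
  by apply: card => v; rewrite -r1; apply: rsQ.
have hQ2 : entropy p (fun t => rho t + s2 t) <= ln #|` Q|%:R.
  by apply: card => v; rewrite -r2; apply: rsQ.
have hX0 : entropy p (x \o w0) <= ln #|` X|%:R by apply: card => v; apply: xX.
have hX1 : entropy p (x \o w1) <= ln #|` X|%:R by apply: card => v; apply: xX.
have hW0 : entropy p w0 <= ln #|W|%:R by exact: entropy_le_ln_card_fintype.
have hW1 : entropy p w1 <= ln #|W|%:R by exact: entropy_le_ln_card_fintype.
have hW2 : entropy p w2 <= ln #|W|%:R by exact: entropy_le_ln_card_fintype.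
have total : entropy p id + entropy p rho *+ 2 = ln #|W|%:R *+ 3.
  exact: entropy_fiber_triple.
(* The edges w1 and w2 stay independent given r: these two bounds say that
   H(w1, w2) = 2 ln |W| - H(r). *)
have E1 : entropy p P + entropy p rho <= entropy p w1 + entropy p w2.
  apply: sub => [v w /f1[] //|v w /f2[] //|v w]; rewrite /P => -> -> //.
have E2 : entropy p id + entropy p rho <= entropy p P + entropy p w0.
  apply: sub => [v w [/f1[] //]|v w /f0[] //|v w [??] ?]; exact: triple_inj.
(* Ruzsa triangle r - s1 = (r + s2) - (s1 + s2): a lower bound for s1 + s2. *)
have E3 : entropy p P <=
    entropy p (fun t => (rho t + s2 t, u t)) + entropy p (x \o w1).
  apply: add => v w [eq eu] ex.
  have ew1 : w1 v = w1 w.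
    apply: d1 => //.
    by rewrite -(subDD _ _ (s2 v)) -[RHS](subDD _ _ (s2 w)) eq -/(u v) eu.
  have [er es1] := f1 _ _ ew1.
  by rewrite /P ew1 (e2 v w) //; move: eq; rewrite er => /addrI.
have E3' := addp _ _ (fun t => rho t + s2 t) u.
(* The sum s1 + s2 stays large given r, and then also given r and s0. *)
have E4 : entropy p P + entropy p u <=
    entropy p (fun t => (rho t, u t)) + entropy p (fun t => (s1 t, s2 t)).
  apply: sub => [v w [] //|v w [a b]|v w [a b] [c d]]; first by rewrite /u a b.
  by rewrite /P (e1 v w) // (e2 v w).
have E4' := addp _ _ s1 s2.
have E5 : entropy p id + entropy p (fun t => (rho t, u t)) <=
    entropy p (fun t => (w0 t, u t)) + entropy p P.
  apply: sub => [v w [/f0[-> _] ->] //|v w [a b]|v w [a _] [b c]]; last exact: triple_inj.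
  by rewrite /u; have [-> ->] := f1 _ _ a; have [_ ->] := f2 _ _ b.
(* The same triangle with the middle term s1 + s2: either r + s1 + s2 or
   s0 + s1 + s2 is larger still. *)
have E6 : entropy p (fun t => (w0 t, u t)) <=
    entropy p (fun t => (m t, sg t)) + entropy p (x \o w0).
  apply: add => v w [em es] ex.
  have ew0 : w0 v = w0 w.
    apply: d0 => //.
    by rewrite -(subDD _ _ (u v)) -[RHS](subDD _ _ (u w)) -/(m v) em -/(sg v) es.
  rewrite ew0; congr (_, _); have [er _] := f0 _ _ ew0.
  by move: em; rewrite /m er => /addrI.
have E6' := addp _ _ m sg.
(* Upper bounds: adding further copies of s to r gains as little as adding the
   first one, because r + s1 + s2 is determined both by s1 and r + s2 and by
   r + s1 and s2. *)
have E7 : entropy p P + entropy p m <=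
    entropy p (fun t => (s1 t, rho t + s2 t)) +
    entropy p (fun t => (rho t + s1 t, s2 t)).
  apply: sub => [v w [a b]|v w [a b]|v w [a b] [c d]].
  - by rewrite /m /u addrCA a b -addrCA.
  - by rewrite /m /u !addrA a b.
  have er : rho v = rho w by move: c; rewrite a => /addIr.
  by rewrite /P (e1 v w) // (e2 v w).
have E7' := addp _ _ s1 (fun t => rho t + s2 t).
have E7'' := addp _ _ (fun t => rho t + s1 t) s2.
have E8 : entropy p id + entropy p n <=
    entropy p (fun t => (s0 t, m t)) +
    entropy p (fun t => (rho t + s0 t, (s1 t, s2 t))).
  apply: sub => [v w [a b]|v w [a b c]|v w [a b] [c d e]].
  - by rewrite /n /sg addrCA a -/(m v) b -addrCA.
  - by rewrite /n /sg /u !addrA a b c.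
  have er : rho v = rho w by move: c; rewrite a => /addIr.
  by apply: triple_inj; [apply: e0 | apply: e1 | apply: e2].
have E8' := addp _ _ s0 m.
have E8'' := addp _ _ (fun t => rho t + s0 t) (fun t => (s1 t, s2 t)).
(* Given r, the sums s0 + s1 + s2 and r + s0 + s1 + s2 carry the same
   information, and s0 + s1 + s2 is nearly independent of r. *)
have E9 : entropy p id + entropy p sg <=
    entropy p (fun t => (rho t, sg t)) + entropy p (fun t => (s0 t, (s1 t, s2 t))).
  apply: sub => [v w [] //|v w [a b c]|v w [er _] [a b c]].
    by rewrite /sg /u a b c.
  by apply: triple_inj; [apply: e0 | apply: e1 | apply: e2].
have E9' : entropy p (fun t => (rho t, sg t)) <= entropy p rho + entropy p n.
  by apply: add => v w er; rewrite /n er => /addrI ->.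
have E9'' := addp _ _ s0 (fun t => (s1 t, s2 t)).
lra.
Qed.

(** * Growth of sumsets *)

Lemma sumsetP (G : zmodType) (A B : {fset G}) (g : G) :
  reflect (exists a b, [/\ a \in A, b \in B & g = a + b]) (g \in sumset A B).
Proof.
apply: (iffP (imfset2P _ _ _ _ _)) => [[a aA [b bB ->]]|[a [b [aA bB ->]]]].
  by exists a, b.
by exists a => //; exists b.
Qed.

Lemma mem_sumset (G : zmodType) (A B : {fset G}) (a b : G) :
  a \in A -> b \in B -> a + b \in sumset A B.
Proof. by move=> aA bB; apply/sumsetP; exists a, b. Qed.

Lemma sumsetS (G : zmodType) (A A' B : {fset G}) :
  (A `<=` A' -> sumset A B `<=` sumset A' B)%fset.
Proof.
move=> /fsubsetP sAA'; apply/fsubsetP => _ /sumsetP[a [b [aA bB ->]]].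
by rewrite mem_sumset // sAA'.
Qed.

Lemma card_translate (G : zmodType) (c : G) (A : {fset G}) :
  #|` [fset (a + c)%R | a in A]%fset| = #|` A|.
Proof. by rewrite card_imfset //; apply: addIr. Qed.

(** Petridis's inequality, by induction on C.  Adjoin c to C' and let X' be the
    set of g in X with g + A + c inside X + A + C'.  The new elements of
    X + A + C number at most |X + A| - |X' + A|, and those of X + C at least
    |X| - |X'|, since g + c in X + C' forces g in X'.  Minimality of the growth
    of X, applied to X', compares the two. *)
Lemma card_sumset_min_growth (G : zmodType) (X A : {fset G}) :
    (forall X' : {fset G}, (X' `<=` X)%fset ->
      (#|` sumset X A| * #|` X'| <= #|` sumset X' A| * #|` X|)%N) ->
  forall C : {fset G},
    (#|` sumset (sumset X A) C| * #|` X| <= #|` sumset X A| * #|` sumset X C|)%N.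
Proof.
move=> minX; apply: finSet_rect => C IH.
have [->|/fset0Pn[c cC]] := eqVneq C fset0.
  rewrite (_ : sumset (sumset X A) fset0 = fset0) ?cardfs0 //.
  by apply/fsetP => g; rewrite inE; apply/sumsetP => -[a [b []]].
have {IH} := IH _ (fproperD1 cC); set C' := (C `\ c)%fset => IH.
have CE g : g \in C -> g = c \/ g \in C'.
  by move=> gC; rewrite !inE gC andbT; case: eqVneq; [left | right].
have C'C g : g \in C' -> g \in C by rewrite !inE => /andP[].
pose X' := [fset g in X | all (fun a => (g + a + c)%R \in sumset (sumset X A) C') A]%fset.
have X'X : (X' `<=` X)%fset by apply/fsubsetP => g; rewrite !inE => /andP[].
have upper : (#|` sumset (sumset X A) C| <= #|` sumset (sumset X A) C'| +
    (#|` sumset X A| - #|` sumset X' A|))%N.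
  rewrite -cardfsDS ?sumsetS // -(card_translate c (_ `\` _)%fset).
  rewrite -cardfsUI.
  rewrite (leq_trans _ (leq_addr _ _)) // fsubset_leq_card //.
  apply/fsubsetP => _ /sumsetP[b [d [bB /CE[->|dC'] ->]]]; last first.
    by rewrite inE mem_sumset.
  rewrite inE; case: (boolP (_ \in sumset _ C')) => //= bc.
  apply/imfsetP; exists b => //=; rewrite inE bB andbT.
  apply: contraNN bc => /sumsetP[g [a [gX' aA ->]]].
  by move: gX'; rewrite !inE => /andP[_ /allP]; apply.
have lower : (#|` sumset X C'| + (#|` X| - #|` X'|) <= #|` sumset X C|)%N.
  rewrite -cardfsDS // -(card_translate c (_ `\` _)%fset).
  rewrite -cardfsUI.
  rewrite (_ : (_ `&` _)%fset = fset0) ?cardfs0 ?addn0; last first.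
    apply/fsetP => g; rewrite !inE; apply/negP => /andP[/sumsetP[x [d [xX dC' ->]]]].
    case/imfsetP => y /=; rewrite !inE => /andP[yX' yX] E.
    move: yX'; rewrite yX /= => /negP; apply; apply/allP => a aA.
    by rewrite addrAC -E addrAC mem_sumset // mem_sumset.
  rewrite fsubset_leq_card //; apply/fsubsetP => g; rewrite inE.
  case/orP => [/sumsetP[x [d [xX dC' ->]]]|/imfsetP[y /= yX' ->]].
    by rewrite mem_sumset // C'C.
  by rewrite mem_sumset //; move: yX'; rewrite inE => /andP[].
have := minX X' X'X; have := fsubset_leq_card X'X.
have := fsubset_leq_card (sumsetS A X'X).
nia.
Qed.

Lemma exists_min_growth (G : zmodType) (A : {fset G}) : A != fset0 ->
  exists X : {fset G}, [/\ (X `<=` A)%fset, X != fset0 &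
    forall X' : {fset G}, (X' `<=` A)%fset ->
      (#|` sumset X A| * #|` X'| <= #|` sumset X' A| * #|` X|)%N].
Proof.
move=> A0.
pose F (X : fpowerset A) : rat := #|` sumset (val X) A|%:R / #|` val X|%:R.
have AA : A \in fpowerset A by rewrite fpowersetE.
have [X X0 minX] := @arg_minP _ _ _ [` AA]%fset (fun X => val X != fset0) F A0.
exists (val X); split=> // [|X' sX']; first by rewrite -fpowersetE (valP X).
have [->|X'0] := eqVneq X' fset0; first by rewrite cardfs0 muln0.
have X'A : X' \in fpowerset A by rewrite fpowersetE.
have := minX [` X'A]%fset X'0; rewrite /F /=.
rewrite ler_pdivrMr ?ltr0n ?cardfs_gt0 // mulrAC ler_pdivlMr ?ltr0n ?cardfs_gt0 //.
by rewrite -!natrM ler_nat.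
Qed.

(** * Differences with the dilate *)

Theorem theorem11 (R : realType) (G : zmodType) (A : {fset G}) (K : R)
    (A_nonempty : A != fset0)
    (hK : (maxn #|` sumset A A| #|` diffset A A|)%:R <= K * #|` A|%:R) :
  #|` diffset A (dilate2 A)|%:R <= K `^ (295%:R / 100%:R) * #|` A|%:R.
Proof.
have [X [XA X0 minX]] := exists_min_growth A_nonempty.
have a_gt0 : 0 < #|` A|%:R :> R by rewrite ltr0n cardfs_gt0.
have n_gt0 : 0 < #|` X|%:R :> R by rewrite ltr0n cardfs_gt0.
have [hp hm] : #|` sumset A A|%:R <= K * #|` A|%:R /\
               #|` diffset A A|%:R <= K * #|` A|%:R.
  by split; apply: le_trans hK; rewrite ler_nat ?leq_maxl ?leq_maxr.
have K_ge1 : 1 <= K.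
  rewrite -(ler_pM2r a_gt0) mul1r; apply: le_trans hp; rewrite ler_nat.
  have /fset0Pn[c cA] := A_nonempty; rewrite -(card_translate c A).
  apply: fsubset_leq_card; apply/fsubsetP => _ /imfsetP[b /= bA ->].
  exact: mem_sumset.
have K_gt0 : 0 < K by lra.
(* The three sets that contain s, r + s and r. *)
pose N := [fset (- a)%R | a in A]%fset.
pose S := sumset X A; pose Q := sumset S A; pose B := sumset S N.
have plunnecke C : #|` sumset S C|%:R * #|` X|%:R <=
                   #|` S|%:R * #|` sumset X C|%:R :> R.
  rewrite -!natrM ler_nat; apply: card_sumset_min_growth => X' /fsubset_trans/(_ XA).
  exact: minX.
have bS : #|` S|%:R <= K * #|` X|%:R.
  have : (#|` S| * #|` A|)%:R <= (#|` sumset A A| * #|` X|)%:R :> R.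
    by rewrite ler_nat minX.
  rewrite !natrM => h; rewrite -(ler_pM2r a_gt0); apply: (le_trans h).
  by rewrite mulrAC ler_pM2r.
have bQ : #|` Q|%:R <= K ^+ 2 * #|` X|%:R.
  rewrite -(ler_pM2r n_gt0); apply: (le_trans (plunnecke A)).
  have -> : K ^+ 2 * #|` X|%:R * #|` X|%:R = (K * #|` X|%:R) * (K * #|` X|%:R).
    by ring.
  by rewrite ler_pM.
have bB : #|` B|%:R <= K ^+ 2 * #|` A|%:R.
  rewrite -(ler_pM2r n_gt0); apply: (le_trans (plunnecke N)).
  have -> : K ^+ 2 * #|` A|%:R * #|` X|%:R = (K * #|` X|%:R) * (K * #|` A|%:R).
    by ring.
  rewrite ler_pM //; apply: le_trans hm; rewrite ler_nat fsubset_leq_card //.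
  apply/fsubsetP => _ /sumsetP[x [_ [xX /imfsetP[a /= aA ->] ->]]].
  by apply/imfset2P; exists x; [apply: (fsubsetP XA) | exists a].
pose D := diffset A (dilate2 A).
have [yz yzP] : {yz : D -> G * G & forall d,
    [/\ (yz d).1 \in A, (yz d).2 \in A & val d = (yz d).1 - (yz d).2 *+ 2]}.
  apply: (@boolp.choice _ _ (fun (d : D) (p : G * G) =>
    [/\ p.1 \in A, p.2 \in A & val d = p.1 - p.2 *+ 2])) => -[d dD] /=.
  have /imfset2P[y /= yA [_ /imfsetP[z /= zA ->] ->]] := dD.
  by exists (y, z).
pose r (w : D * X) := (yz w.1).1 - (yz w.1).2 + val w.2.
pose s (w : D * X) := (yz w.1).2 + val w.2.
have rBs w : r w - s w = val w.1.
  have [_ _ ->] := yzP w.1.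
  by rewrite /r /s opprD addrACA subrr addr0 mulr2n opprD addrA.
(* The sum has no z left, which is what places it in X + A + A. *)
have rDs w : r w + s w = val w.2 + (yz w.1).1 + val w.2.
  by rewrite /r /s addrACA subrK addrA [(yz _).1 + _]addrC.
have sS w : s w \in S.
  by have [_ zA _] := yzP w.1; rewrite /s addrC mem_sumset // fsvalP.
have rB w : r w \in B.
  have [yA zA _] := yzP w.1; rewrite /r addrAC [_ + val _]addrC.
  by rewrite !mem_sumset ?fsvalP //; apply/imfsetP; exists (yz w.1).2.
have rsQ w : r w + s w \in Q.
  have [yA _ _] := yzP w.1.
  by rewrite rDs !mem_sumset ?fsvalP // (fsubsetP XA) ?fsvalP.
have cW : #|{: D * X}| = (#|` D| * #|` X|)%N by rewrite card_prod -!cardfE.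
have D0 : (0 < #|` D|)%N.
  have /fset0Pn[c cA] := A_nonempty; rewrite cardfs_gt0; apply/fset0Pn.
  exists (c - c *+ 2); apply/imfset2P; exists c => //.
  by exists (c *+ 2) => //; apply/imfsetP; exists c.
have d_gt0 : 0 < #|` D|%:R :> R by rewrite ltr0n.
have key := @ln_card_sum_difference R G (D * X)%type G r s (fun w => val w.2)
  B S Q X.
rewrite cW muln_gt0 D0 cardfs_gt0 X0 in key.
have {}key : 15 * (ln #|` D|%:R + ln #|` X|%:R) <= 10 * ln #|` B|%:R +
    12 * ln #|` S|%:R + 6 * ln #|` Q|%:R + 2 * ln #|` X|%:R :> R.
  rewrite -lnM ?posrE // -natrM; apply: key => // [w|[d x] [d' x'] er es|[d x] [d' x'] e ex].
  - exact: fsvalP.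
  - have /val_inj /= ed : val d = val d' by rewrite -(rBs (d, x)) er es rBs.
    by move: er; rewrite /r /= ed => /addrI/val_inj ->.
  - by move: e ex; rewrite !rBs /= => /val_inj -> /val_inj ->.
have ln_le_card (Z : {fset G}) (b : R) : Z != fset0 -> #|` Z|%:R <= b ->
    ln #|` Z|%:R <= ln b.
  move=> Z0 Zb; have Z_gt0 : 0 < #|` Z|%:R :> R by rewrite ltr0n cardfs_gt0.
  by rewrite ler_ln // posrE (lt_le_trans Z_gt0).
have /fset0Pn[d0 d0D] : D != fset0 by rewrite -cardfs_gt0.
have /fset0Pn[x0 x0X] := X0.
pose w0 : D * X := ([` d0D]%fset, [` x0X]%fset).
have lS : ln #|` S|%:R <= ln (K * #|` X|%:R).
  by apply: ln_le_card => //; apply/fset0Pn; exists (s w0).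
have lQ : ln #|` Q|%:R <= ln (K ^+ 2 * #|` X|%:R).
  by apply: ln_le_card => //; apply/fset0Pn; exists (r w0 + s w0).
have lB : ln #|` B|%:R <= ln (K ^+ 2 * #|` A|%:R).
  by apply: ln_le_card => //; apply/fset0Pn; exists (r w0).
have lX : ln #|` X|%:R <= ln #|` A|%:R :> R.
  by apply: ln_le_card => //; rewrite ler_nat fsubset_leq_card.
rewrite !lnM ?posrE ?exprn_gt0 // in lS lQ lB.
have lK : 0 <= ln K by apply: ln_ge0.
(* Now 15 ln |D| <= 44 ln K + 10 ln |A| + 5 ln |X|, and 44/15 < 2.95. *)
rewrite -ler_ln ?posrE ?mulr_gt0 ?powR_gt0 // lnM ?posrE ?powR_gt0 // ln_powR.
lra.
Qed.
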